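(* Assume that $f$ is concave in $\Gamma$, that $f_i(\lambda)\ge 0$ in $\Gamma$ for all $1\le i\le n$, and that $$\liminf_{|\lambda|\to+\infty,\ \lambda\in\partial\Gamma^\sigma} t_\lambda>-\infty .$$ Then there exists a uniform positive constant $\vartheta_{\Gamma_{\sigma,f}}$ depending only on $\Gamma_{\sigma,f}$ such that for each $\lambda\in\partial\Gamma^\sigma$ with $\lambda_1\le\cdots\le\lambda_n$, $$f_i(\lambda)\ \ge\ \vartheta_{\Gamma_{\sigma,f}}\sum_{j=1}^n f_j(\lambda),\qquad \forall\, 1\le i\le 1+\kappa_{\Gamma_{\sigma,f}} .$$
   Context: $f$ is a smooth symmetric function on an open symmetric convex cone $\Gamma\subset\mathbb{R}^n$ with vertex at the origin and nonempty boundary, containing the positive cone $\Gamma_n=\{\lambda\in\mathbb{R}^n:\ \lambda_i>0\ \forall i\}$. Write $f_i=\partial f/\partial\lambda_i$, $\vec{\mathbf 1}=(1,\dots,1)$ and $\partial\Gamma^\sigma=\{\lambda\in\Gamma: f(\lambda)=\sigma\}$. Standing assumptions on $\sigma$: $\sigma<\sup_\Gamma f$, $\partial\Gamma^\sigma\ne\emptyset$, and $\partial\Gamma^\sigma$ is a smooth complete (i.e. closed in $\mathbb{R}^n$) noncompact convex hypersurface. Let $c_\sigma>0$ be the constant with $f(c_\sigma\vec{\mathbf 1})=\sigma$. For $\lambda\in\partial\Gamma^\sigma$ (where $\sum_j f_j(\lambda)>0$) put $$t_\lambda=\frac{\sum_{i=1}^n f_i(\lambda)\lambda_i}{\sum_{j=1}^n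 f_j(\lambda)},\qquad \tau_\sigma=\inf_{\lambda\in\partial\Gamma^\sigma}t_\lambda ,$$ and it is assumed throughout that $\tau_\sigma<c_\sigma$. (A liminf over an empty set of sequences is $+\infty$.) Define $$\Gamma_{\sigma,f}=\{t(\lambda-\tau_\sigma\vec{\mathbf 1}):\ \lambda\in\partial\Gamma^\sigma,\ t>0\},$$ $$\kappa_{\Gamma_{\sigma,f}}=\max\{k:\ (-\alpha_1,\dots,-\alpha_k,\alpha_{k+1},\dots,\alpha_n)\in\Gamma_{\sigma,f}\ \text{for some } \alpha_1,\dots,\alpha_n>0\}.$$ *)

(* Defs.v *)
From HB Require Import structures.
From mathcomp Require Import all_boot all_order all_fingroup all_algebra.
From mathcomp Require Import all_classical all_reals all_analysis.
Set Implicit Arguments.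
Unset Strict Implicit.
Unset Printing Implicit Defensive.
Import Order.TTheory GRing.Theory Num.Theory.
Import numFieldNormedType.Exports.
Local Open Scope classical_set_scope.
Local Open Scope ring_scope.

(* Coordinates of R^n are indexed from 0 to n - 1. *)

Definition ones {R : realType} {n : nat} : 'rV[R]_n := const_mx 1.

Definition partial {R : realType} {n : nat} (i : 'I_n) (g : 'rV[R]_n -> R) :
  'rV[R]_n -> R := fun x => 'D_(delta_mx 0 i) g x.

(* g is C^oo on U, for U open: all its iterated partial derivatives are Frechet
   differentiable (hence exist and are continuous) on U. The values of g outside
   of U are irrelevant. *)
Definition smooth_on {R : realType} {n : nat} (U : set 'rV[R]_n)
    (g : 'rV[R]_n -> R) : Prop :=
  forall (s : seq 'I_n) (x : 'rV[R]_n), U x ->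
    differentiable (foldr partial g s) x.

Definition concave_on {R : realType} {n : nat} (A : set 'rV[R]_n)
    (g : 'rV[R]_n -> R) : Prop :=
  @convex_function R 'rV[R]_n A (fun x => - g x).

Definition frontier {R : realType} {n : nat} (A : set 'rV[R]_n) :
  set 'rV[R]_n := closure A `\` interior A.

Definition positive_cone {R : realType} {n : nat} : set 'rV[R]_n :=
  [set x | forall i, 0 < x 0 i].

Definition symmetric_set {R : realType} {n : nat} (A : set 'rV[R]_n) : Prop :=
  forall (s : 'S_n) x, A x -> A (col_perm s x).

Definition symmetric_fun_on {R : realType} {n : nat} (A : set 'rV[R]_n)
    (g : 'rV[R]_n -> R) : Prop :=
  forall (s : 'S_n) x, A x -> g (col_perm s x) = g x.

Definition admissible_cone {R : realType} {n : nat} (Gamma : set 'rV[R]_n) :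
    Prop :=
  [/\ open Gamma,
      symmetric_set Gamma,
      @convex_set R 'rV[R]_n Gamma,
      (forall (t : R) x, 0 < t -> Gamma x -> Gamma (t *: x)) &
      frontier Gamma !=set0 /\ positive_cone `<=` Gamma].

Definition level_set {R : realType} {n : nat} (Gamma : set 'rV[R]_n)
    (f : 'rV[R]_n -> R) (sigma : R) : set 'rV[R]_n :=
  [set x | Gamma x /\ f x = sigma].

(* Embedded smooth submanifold of codimension 1, by local defining functions. *)
Definition smooth_hypersurface {R : realType} {n : nat} (S : set 'rV[R]_n) :
    Prop :=
  forall p, S p -> exists (U : set 'rV[R]_n) (phi : 'rV[R]_n -> R),
    [/\ open U, U p, smooth_on U phi,
        S `&` U = [set x | phi x = 0] `&` U &
        forall x, U x -> exists i, partial i phi x != 0].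

(* S is the whole boundary of a closed convex set with nonempty interior. *)
Definition convex_hypersurface {R : realType} {n : nat} (S : set 'rV[R]_n) :
    Prop :=
  exists K : set 'rV[R]_n,
    [/\ @convex_set R 'rV[R]_n K, closed K, interior K !=set0 &
        S = frontier K].

Definition tlambda {R : realType} {n : nat} (f : 'rV[R]_n -> R)
    (x : 'rV[R]_n) : R :=
  (\sum_i partial i f x * x 0 i) / (\sum_j partial j f x).

(* The filter |x| -> +oo, x \in A. The norm is the library's sup norm, which
   yields the same filter as the Euclidean one. When A is bounded, set0 belongs
   to the filter, and limf_einf along it is +oo. *)
Definition at_infinity_in {R : realType} {n : nat} (A : set 'rV[R]_n) :
    set_system 'rV[R]_n :=
  filter_from [set: R] (fun r => [set x | A x /\ r < `|x|]).

Definition liminf_tlambda {R : realType} {n : nat} (Gamma : set 'rV[R]_n)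
    (f : 'rV[R]_n -> R) (sigma : R) : \bar R :=
  limf_einf (fun x => (tlambda f x)%:E)
    (at_infinity_in (level_set Gamma f sigma)).

(* Real-valued infimum: it has its usual meaning only if t is bounded below on
   the level set. This holds as soon as the level set is closed, f is C^1 with
   \sum_j f_j > 0 on it, and liminf_tlambda Gamma f sigma > -oo. *)
Definition tau {R : realType} {n : nat} (Gamma : set 'rV[R]_n)
    (f : 'rV[R]_n -> R) (sigma : R) : R :=
  inf (tlambda f @` level_set Gamma f sigma).

Definition Gamma_sigma {R : realType} {n : nat} (Gamma : set 'rV[R]_n)
    (f : 'rV[R]_n -> R) (sigma : R) : set 'rV[R]_n :=
  [set mu | exists (t : R) (x : 'rV[R]_n),
    [/\ 0 < t, level_set Gamma f sigma x &
        mu = t *: (x - tau Gamma f sigma *: ones)]].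

(* The first k coordinates of the vector are negative, the others positive. *)
Definition kappa {R : realType} {n : nat} (C : set 'rV[R]_n) : nat :=
  \max_(k < n.+1 | `[< exists alpha : 'rV[R]_n,
      (forall i, 0 < alpha 0 i) /\
      C (\row_i (if (i < k)%N then - alpha 0 i else alpha 0 i)) >]) k.

(* Standing assumptions on the level sigma; c is the constant c_sigma. *)
Definition admissible_level {R : realType} {n : nat} (Gamma : set 'rV[R]_n)
    (f : 'rV[R]_n -> R) (sigma c : R) : Prop :=
  let S := level_set Gamma f sigma in
  [/\ (sigma%:E < ereal_sup [set (f x)%:E | x in Gamma])%E,
      S !=set0,
      [/\ smooth_hypersurface S, closed S, ~ compact S & convex_hypersurface S],
      0 < c /\ f (c *: ones) = sigma &
      tau Gamma f sigma < c].

(* Main.v *)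
Require Import Defs.
From mathcomp Require Import all_boot all_order all_fingroup all_algebra.
From mathcomp Require Import all_classical all_reals all_analysis.
From mathcomp Require Import ring lra.

(** Write v for the gradient of f at a point lambda of the level set S. The
    proof shows that v lies in the dual cone of C = Gamma_sigma, and then that
    membership in this dual cone, together with the nonnegativity and the
    ordering of the entries of v, already forces the estimate, with a constant
    that is read off from C.

    For mu in S, concavity places the graph of f below its tangent hyperplane
    at lambda ([concave_le_tangent]), so <v, mu - lambda> >= f mu - f lambda = 0.
    Since <v, lambda> = t_lambda |v|_1 >= tau |v|_1, this gives
    <v, mu - tau 1> >= 0, that is, <v, nu> >= 0 for all nu in C. Here t_lambda
    only makes sense because |v|_1 > 0 ([sum_partial_gt0]): a critical point of
    a concave function is a maximum, whereas sigma is below the supremum. And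
    tau is a true lower bound because t is bounded below on S: far away by the
    hypothesis on the liminf ([liminf_bounded_below]), and elsewhere by
    - |lambda| ([tlambda_ge_norm]), as t_lambda is a weighted mean of the
    coordinates of lambda.

    By symmetry and concavity, the smaller of two coordinates of lambda carries
    the larger partial derivative ([partial_antitone]), so the entries of v
    decrease along the increasing vector lambda. Finally, if k = kappa C > 0 and
    (-alpha_0, ..., -alpha_(k-1), alpha_k, ..., alpha_(n-1)) is in C, then
    testing v against this vector gives
    alpha_0 v_0 <= sum_(j >= k) alpha_j v_j <= v_i sum_j alpha_j for i <= k,
    while v_0 >= |v|_1 / n ([dual_cone_bound]). The vector alpha is chosen as a
    function of C alone, which makes the constant uniform. *)
Set Implicit Arguments.
Unset Strict Implicit.
Unset Printing Implicit Defensive.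
Import Order.TTheory GRing.Theory Num.Theory.
Import numFieldNormedType.Exports.
Local Open Scope classical_set_scope.
Local Open Scope ring_scope.

Lemma derive_sum_partial (R : realType) (n : nat) (g : 'rV[R]_n -> R)
    (x v : 'rV[R]_n) :
  differentiable g x -> 'D_v g x = \sum_i partial i g x * v 0 i.
Proof.
move=> dg; rewrite deriveE// {1}(row_sum_delta v) linear_sum.
by apply: eq_bigr => i _; rewrite linearZ/= /partial deriveE// mulrC.
Qed.

(** Along the segment from x to y, concavity bounds the difference quotients of
    g at x from below by g y - g x; their limit is the directional derivative
    of g along y - x. *)
Lemma concave_le_tangent (R : realType) (n : nat) (A : set 'rV[R]_n)
    (g : 'rV[R]_n -> R) (x y : 'rV[R]_n) :
  concave_on A g -> A x -> A y -> differentiable g x ->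
  g y - g x <= \sum_i partial i g x * (y 0 i - x 0 i).
Proof.
move=> cg Ax Ay dg.
have -> : \sum_i partial i g x * (y 0 i - x 0 i) = 'D_(y - x) g x.
  by rewrite derive_sum_partial//; apply: eq_bigr => i _; rewrite !mxE.
have dv : derivable g x (y - x) by exact: diff_derivable.
rewrite /derive cvg_at_rightE//; apply: limr_ge.
  by apply/cvg_ex; exists ('D_(y - x) g x); apply: cvg_dnbhs_at_right.
near=> t.
have t0 : 0 < t by [].
have t1 : t <= 1 by near: t; exact: nbhs_right_le.
have := cg (Itv01 (ltW t0) t1) y x (mem_set Ay) (mem_set Ax).
rewrite convRE /= /unstable.onem.
have -> : @conv R (convex_lmodType 'rV[R]_n) (Itv01 (ltW t0) t1) y x =
    t *: (y - x) + x.
  by rewrite /conv/= /unstable.onem scalerBl scale1r scalerBr addrCA addrC.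
move=> h; rewrite /shift/= [_ *: _]mulrC ler_pdivlMr//.
by lra.
Unshelve. all: by end_near. Qed.

(** If x_i < x_j, compare x with its image under the exchange of the coordinates
    i and j: the value of g is the same, so the tangent inequality reads
    (g_i - g_j) (x_j - x_i) >= 0. If x_i = x_j this is void, but then the
    exchange fixes x and carries the direction e_i to e_j, so that the two
    derivatives agree. *)
Lemma partial_antitone (R : realType) (n : nat) (A : set 'rV[R]_n)
    (g : 'rV[R]_n -> R) (x : 'rV[R]_n) (i j : 'I_n) :
  open A -> symmetric_set A -> symmetric_fun_on A g -> concave_on A g ->
  A x -> differentiable g x ->
  x 0 i <= x 0 j -> partial j g x <= partial i g x.
Proof.
move=> oA sA sg cg Ax dg; rewrite le_eqVlt => /orP[/eqP xij|xij].
  have xE : col_perm (tperm i j) x = x.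
    by apply/rowP => k; rewrite mxE; case: tpermP => [->|->|].
  suff -> : partial j g x = partial i g x by [].
  rewrite /partial.
  have -> : 'D_(delta_mx 0 i) g x =
      'D_(delta_mx 0 i) (g \o col_perm (tperm i j)) x.
    apply: near_eq_derive.
    have : \forall y \near x, A y by exact: open_nbhs_nbhs.
    by apply: filterS => y Ay; rewrite /= sg.
  rewrite /derive; set q := (fun h : R => _); set q' := (fun h : R => _).
  suff -> : q = q' by []; apply/funext => h; rewrite /q /q'/=.
  suff sE : col_perm (tperm i j) (h *: 'e_i + x) = h *: 'e_j + x.
    by rewrite /shift/= sE xE.
  rewrite linearD/= xE; congr (_ + _).
  apply/rowP => k; rewrite !mxE/=; congr (_ * (nat_of_bool _)%:R).
  by rewrite -{2}(tpermR i j) (inj_eq perm_inj).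
have nij : j != i by apply: contraTneq xij => ->; rewrite ltxx.
have := concave_le_tangent cg Ax (sA (tperm i j) _ Ax) dg.
rewrite sg// subrr (bigD1 i)//= (bigD1 j)//= big1 ?addr0; last first.
  move=> k /andP[ki kj]; rewrite mxE tpermD 1?eq_sym//.
  by rewrite subrr mulr0.
rewrite !mxE tpermL tpermR => h.
have : 0 <= (partial i g x - partial j g x) * (x 0 j - x 0 i) by lra.
by rewrite pmulr_lge0 ?subr_gt0// subr_ge0.
Qed.

Lemma kappa_attained (R : realType) (n : nat) (C : set 'rV[R]_n) :
  (0 < kappa C)%N -> exists alpha : 'rV[R]_n, (forall i, 0 < alpha 0 i) /\
    C (\row_i (if (i < kappa C)%N then - alpha 0 i else alpha 0 i)).
Proof.
rewrite /kappa; set P := (X in \max_(k < _ | X k) _) => k0.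
have [k Pk|P0] := pickP P; last by move: k0; rewrite big_pred0.
have [|m /asboolP Pm ->] := @eq_bigmax_cond _ P (fun k : 'I_n.+1 => k : nat).
  by apply/card_gt0P; exists k.
exact: Pm.
Qed.

(** The part of the proof that produces the uniform constant: the vector v
    ranges over all the nonincreasing nonnegative elements of the dual cone of C,
    while theta is chosen before v. *)
Lemma dual_cone_bound (R : realType) (n : nat) (C : set 'rV[R]_n) :
  exists theta : R, 0 < theta /\
    forall v : 'I_n -> R, (forall i, 0 <= v i) ->
      (forall i j : 'I_n, (i <= j)%N -> v j <= v i) ->
      (forall nu, C nu -> 0 <= \sum_i v i * nu 0 i) ->
      forall i : 'I_n, (i <= kappa C)%N -> theta * \sum_j v j <= v i.
Proof.
case: n C => [|n] C; first by exists 1; split=> // v _ _ _ [].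
suff [c [c0 cP]] : exists c : R, 0 < c /\ forall v : 'I_n.+1 -> R,
    (forall i, 0 <= v i) ->
    (forall i j : 'I_n.+1, (i <= j)%N -> v j <= v i) ->
    (forall nu, C nu -> 0 <= \sum_i v i * nu 0 i) ->
    forall i : 'I_n.+1, (i <= kappa C)%N -> c * v ord0 <= v i.
  (* The largest entry of v is v_0, so the sum of the entries is at most
     n.+1 * v_0. *)
  exists (c / n.+1%:R); split; first by rewrite divr_gt0.
  move=> v v0 vanti vC i ik; apply: le_trans (cP v v0 vanti vC i ik).
  rewrite -mulrA ler_pM2l// ler_pdivrMl//.
  rewrite mulr_natl -[in leRHS](card_ord n.+1) -sumr_const.
  by apply: ler_sum => j _; exact: vanti.
have [k0|k0] := posnP (kappa C).
  exists 1; split=> // v _ _ _ i; rewrite k0 leqn0 => /eqP i0.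
  by rewrite mul1r (_ : i = ord0)//; exact/val_inj.
have [a [a0 aC]] := kappa_attained k0.
set B := \sum_i a 0 i.
have B0 : 0 < B.
  by rewrite /B (bigD1 ord0)//= ltr_pwDl// sumr_ge0// => i _; exact: ltW.
exists (a 0 ord0 / B); split; first by rewrite divr_gt0.
move=> v v0 vanti vC i ik; rewrite mulrAC ler_pdivrMr// -subr_ge0.
apply: le_trans (vC _ aC) _.
(* The sums are compared term by term; the index 0 is set apart because its
   term - v_0 a_0 on the left also occurs on the right. *)
rewrite /B mulr_sumr (bigD1 ord0)//= [in leRHS](bigD1 ord0)//= mxE k0.
have h0 : 0 <= v i * a 0 ord0 by rewrite mulr_ge0// ltW.
set s := \sum_(_ | _) _; set t := \sum_(_ | _) _.
suff : s <= t by lra.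
apply: ler_sum => j _; rewrite mxE; case: ltnP => [jk|kj].
  rewrite mulrN (@le_trans _ _ 0) ?oppr_le0// mulr_ge0// ltW//.
by rewrite ler_pM2r// vanti// (leq_trans ik).
Qed.

Lemma liminf_bounded_below (R : realType) (n : nat) (A : set 'rV[R]_n)
    (t : 'rV[R]_n -> R) :
  (-oo < limf_einf (fun x => (t x)%:E) (at_infinity_in A))%E ->
  exists r M : R, forall x, A x -> r < `|x| -> M <= t x.
Proof.
rewrite limf_einfE => /ereal_sup_gt[_ [V [r _ rV] <-]] VNy.
exists r; set m := ereal_inf _ in VNy *.
exists (fine m) => x Ax rx.
have mt : (m <= (t x)%:E)%E by apply: ereal_inf_lbound; exists x => //; exact: rV.
rewrite -lee_fin fineK// fin_numE -ltNye VNy/=.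
by rewrite -ltey (le_lt_trans mt)// ltry.
Qed.

(** A mean of the coordinates of x with nonnegative weights is at least their
    minimum. If all the weights vanish, the quotient is 0 by convention and the
    bound persists. *)
Lemma tlambda_ge_norm (R : realType) (n : nat) (g : 'rV[R]_n -> R)
    (x : 'rV[R]_n) :
  (forall i, 0 <= partial i g x) -> - `|x| <= tlambda g x.
Proof.
move=> g0; have : 0 <= \sum_i partial i g x by rewrite sumr_ge0.
rewrite le_eqVlt => /orP[/eqP s0|s0].
  by rewrite /tlambda -s0 invr0 mulr0 oppr_le0.
rewrite /tlambda ler_pdivlMr// mulr_sumr; apply: ler_sum => i _.
rewrite mulrC ler_wpM2l// lerNl.
apply: (@le_trans _ _ `|x 0 i|); first by rewrite -normrN ler_norm.
rewrite (_ : `|x| = mx_norm x)// mx_normrE.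
exact: (le_bigmax _ (fun ij => `|x ij.1 ij.2|) (0, i)).
Qed.

(** Otherwise x would be a critical point of the concave function g, hence a
    global maximum. *)
Lemma sum_partial_gt0 (R : realType) (n : nat) (A : set 'rV[R]_n)
    (g : 'rV[R]_n -> R) (x : 'rV[R]_n) :
  concave_on A g -> A x -> differentiable g x ->
  (forall i, 0 <= partial i g x) ->
  ((g x)%:E < ereal_sup [set (g y)%:E | y in A])%E ->
  0 < \sum_i partial i g x.
Proof.
move=> cg Ax dg g0 /ereal_sup_gt[_ [y Ay <-]]; rewrite lte_fin => gxy.
rewrite lt0r sumr_ge0// andbT; apply: contraTN gxy => /eqP s0.
have := concave_le_tangent cg Ax Ay dg; rewrite big1 ?subr_le0 -?leNgt//.
by move=> i _; rewrite (psumr_eq0P _ s0)// mul0r.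
Qed.

Theorem theorem1p3 (R : realType) (n : nat) :
  exists theta : set 'rV[R]_n -> R,
    (forall C : set 'rV[R]_n, 0 < theta C) /\
    forall (Gamma : set 'rV[R]_n) (f : 'rV[R]_n -> R) (sigma c : R),
      admissible_cone Gamma ->
      smooth_on Gamma f ->
      symmetric_fun_on Gamma f ->
      admissible_level Gamma f sigma c ->
      concave_on Gamma f ->
      (forall (i : 'I_n) (x : 'rV[R]_n), Gamma x -> 0 <= partial i f x) ->
      (-oo < liminf_tlambda Gamma f sigma)%E ->
      forall lambda : 'rV[R]_n,
        level_set Gamma f sigma lambda ->
        (forall i j : 'I_n, (i <= j)%N -> lambda 0 i <= lambda 0 j) ->
        forall i : 'I_n, (i <= kappa (Gamma_sigma Gamma f sigma))%N ->
          theta (Gamma_sigma Gamma f sigma) * \sum_j partial j f lambda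
            <= partial i f lambda.
Proof.
have [theta thetaP] := choice (@dual_cone_bound R n).
exists theta; split=> [C|]; first by have [] := thetaP C.
move=> Gamma f sigma c [oG sG _ _ _] smf sf [ltsup _ _ _ _] cf f0 linf.
move=> x [Gx fx] xmono.
have df y : Gamma y -> differentiable f y by exact: (smf [::]).
have [_] := thetaP (Gamma_sigma Gamma f sigma); apply.
- by move=> i; exact: f0.
- by move=> i j ij; apply: (partial_antitone oG) => //; [exact: df|exact: xmono].
move=> _ [t [y [t0 [Gy fy] ->]]].
have S0 : 0 < \sum_i partial i f x.
  by apply: (sum_partial_gt0 cf) => //; [exact: df|move=> i; exact: f0|rewrite fx].
have [r [M tM]] := liminf_bounded_below linf.
have tauP : tau Gamma f sigma <= tlambda f x.
  apply: ge_inf; last by exists x.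
  exists (Num.min M (- r)) => _ [z [Gz fz] <-]; rewrite ge_min.
  have [rz|zr] := ltP r `|z|; first by rewrite tM.
  have zt : - `|z| <= tlambda f z by apply: tlambda_ge_norm => i; exact: f0.
  by apply/orP; right; rewrite (le_trans _ zt)// lerN2.
have -> : \sum_i partial i f x * (t *: (y - tau Gamma f sigma *: ones)) 0 i =
    t * (\sum_i partial i f x * (y 0 i - x 0 i) +
      (tlambda f x - tau Gamma f sigma) * \sum_i partial i f x).
  rewrite [(_ - tau _ _ _) * _]mulrBl /tlambda divfK ?gt_eqF//.
  rewrite [tau _ _ _ * _]mulr_sumr addrA -big_split/= -sumrB mulr_sumr.
  by apply: eq_bigr => i _; rewrite !mxE; ring.
(* The first summand is nonnegative by concavity, since f y = f x; the second
   by the definition of tau. *)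
rewrite mulr_ge0 ?(ltW t0)// addr_ge0//.
  by have := concave_le_tangent cf Gx Gy (df _ Gx); rewrite fx fy subrr.
by rewrite mulr_ge0 ?subr_ge0// ltW.
Qed.
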